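(* Let $n\ge 1$ and $s\ge 0$ be integers, let $\alpha_1,\ldots,\alpha_n$ be $n$ different real numbers, and let $X_n=X_n(\alpha_1,\ldots,\alpha_n)\subseteq\mathbb{R}^n$ be the set of all permutations of $\alpha_1,\ldots,\alpha_n$, each permutation being considered as a vector of length $n$. Let $\mathcal{A}\subseteq X_n$ be an $s$-distance set. Then $$|\mathcal{A}|\leq\sum_{i=0}^s I_n(i),$$ where $I_n(i)$ is the number of permutations of $n$ symbols with precisely $i$ inversions.
   Context: For $\mathcal{A}\subseteq\mathbb{R}^n$, let $d(\mathcal{A})=\{d(p_1,p_2): p_1,p_2\in\mathcal{A},\ p_1\neq p_2\}$ be the set of non-zero Euclidean distances among points of $\mathcal{A}$. The set $\mathcal{A}$ is an $s$-distance set if $|d(\mathcal{A})|\le s$. *)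

(* Defs.v *)
From mathcomp Require Import all_boot all_order all_fingroup all_algebra.
From mathcomp Require Import boolp classical_sets functions cardinality reals.

Set Implicit Arguments.
Unset Strict Implicit.
Unset Printing Implicit Defensive.

Import Order.TTheory GRing.Theory Num.Theory.
Local Open Scope classical_set_scope.
Local Open Scope ring_scope.

(* The norm that the library puts on row vectors is the sup norm, hence this
   definition. *)
Definition euclid_dist (R : realType) (n : nat) (p q : 'rV[R]_n) : R :=
  Num.sqrt (\sum_(i < n) (p ord0 i - q ord0 i) ^+ 2).

Definition distance_set (R : realType) (n : nat) (A : set 'rV[R]_n) : set R :=
  [set r | exists p1 p2 : 'rV[R]_n,
    [/\ A p1, A p2, p1 <> p2 & r = euclid_dist p1 p2]].

(* [`I_s] is {0, ..., s-1}, so [B #<= `I_s] says that B is finite with at most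
   s elements. *)
Definition is_s_distance_set (R : realType) (n s : nat) (A : set 'rV[R]_n) :
    Prop :=
  (distance_set A #<= `I_s)%card.

Definition perm_vectors (R : realType) (n : nat) (alpha : 'I_n -> R) :
    set 'rV[R]_n :=
  [set x | exists sigma : 'S_n, x = \row_(i < n) alpha (sigma i)].

(* %SET selects finite sets rather than classical ones. *)
Definition inversions (n : nat) (sigma : 'S_n) : nat :=
  #|[set p : 'I_n * 'I_n | (p.1 < p.2)%N && (sigma p.2 < sigma p.1)%N]%SET|.

Definition num_perm_inv (n i : nat) : nat :=
  #|[set sigma : 'S_n | inversions sigma == i]%SET|.

(* Main.v *)
(* On permutations of alpha the squared norm is constant, so for a in A the
   function f_a(x) = \prod_d (|x - a|^2 - d^2), over the at most s distances d
   of A, is a polynomial in x of degree at most s. Since f_a(b) = 0 exactly when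
   b <> a in A, the f_a are independent, and |A| is at most the dimension of the
   space of functions of degree at most s on the permutations of alpha.

   That space is spanned by the monomials x^u of degree at most s with
   u_k <= k (indices from 0). Indeed \prod_(j <= k) (t - x_j) is the quotient of
   the fixed polynomial \prod_j (t - alpha_j) by \prod_(j > k) (t - x_j), so its
   coefficients are polynomials in x_(k+1), ..., x_(n-1), and evaluating at
   t = x_k expresses x_k^(k+1) by lower powers of x_k without raising the degree.
   These exponents u are the Lehmer codes of the permutations, and the number of
   inversions is the sum of the code. *)
Require Import Defs.
From mathcomp Require Import all_boot all_order all_fingroup all_algebra.
From mathcomp Require Import boolp classical_sets functions cardinality reals.
From mathcomp Require Import ring zify.

Set Implicit Arguments.
Unset Strict Implicit.
Unset Printing Implicit Defensive.

Import Order.TTheory GRing.Theory Num.Theory.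
Local Open Scope ring_scope.

(** * Polynomial functions of bounded degree *)

(* [deg_le x k d f]: [f] is a polynomial of total degree at most [d] in the
   functions [x i] with [k <= i]. *)
Inductive deg_le (T : Type) (R : comNzRingType) (n : nat) (x : 'I_n -> T -> R)
    (k : nat) : nat -> (T -> R) -> Prop :=
| deg_le_cst d c : deg_le x k d (cst c)
| deg_le_add d f g :
    deg_le x k d f -> deg_le x k d g -> deg_le x k d (f + g)
| deg_le_mulX d (i : 'I_n) f :
    (k <= i)%N -> deg_le x k d f -> deg_le x k d.+1 (x i * f).

Lemma deg_le_widen (T : Type) (R : comNzRingType) (n : nat)
    (x : 'I_n -> T -> R) (k d e : nat) (f : T -> R) :
  (d <= e)%N -> deg_le x k d f -> deg_le x k e f.
Proof.
move=> + df; elim: df e => {d f} [d c|d f g _ IHf _ IHg|d i f ki _ IH] e de.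
- exact: deg_le_cst.
- by apply: deg_le_add; [exact: IHf|exact: IHg].
- by case: e de => // e de; apply: deg_le_mulX => //; exact: IH.
Qed.

Lemma deg_le_widen_vars (T : Type) (R : comNzRingType) (n : nat)
    (x : 'I_n -> T -> R) (k l d : nat) (f : T -> R) :
  (k <= l)%N -> deg_le x l d f -> deg_le x k d f.
Proof.
move=> kl; elim=> {d f} [d c|d f g _ IHf _ IHg|d i f li _ IH].
- exact: deg_le_cst.
- exact: deg_le_add.
- by apply: deg_le_mulX => //; exact: leq_trans li.
Qed.

Lemma deg_leM (T : Type) (R : comNzRingType) (n : nat)
    (x : 'I_n -> T -> R) (k d e : nat) (f g : T -> R) :
  deg_le x k d f -> deg_le x k e g -> deg_le x k (d + e) (f * g).
Proof.
move=> df dg; elim: df => {d f} [d c|d f h _ IHf _ IHh|d i f ki _ IH].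
- apply: (@deg_le_widen _ _ _ _ _ e); first exact: leq_addl.
  elim: dg => {e g} [e b|e g h _ IHg _ IHh|e i g ki _ IH].
  + by rewrite (_ : cst c * cst b = cst (c * b)); [exact: deg_le_cst|].
  + by rewrite mulrDr; exact: deg_le_add.
  + by rewrite mulrCA; exact: deg_le_mulX.
- by rewrite mulrDl; exact: deg_le_add.
- by rewrite addSn -mulrA; exact: deg_le_mulX.
Qed.

Lemma deg_leN (T : Type) (R : comNzRingType) (n : nat)
    (x : 'I_n -> T -> R) (k d : nat) (f : T -> R) :
  deg_le x k d f -> deg_le x k d (- f).
Proof.
move=> df; rewrite (_ : - f = cst (-1) * f); last first.
  by apply/funext => t; rewrite !fctE mulN1r.
exact: (@deg_leM _ _ _ _ _ 0 d _ _ (deg_le_cst _ _ _ _)).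
Qed.

Lemma deg_le_sum (T : Type) (R : comNzRingType) (n : nat)
    (x : 'I_n -> T -> R) (k d : nat) (I : Type) (r : seq I) (f : I -> T -> R) :
  (forall i, deg_le x k d (f i)) -> deg_le x k d (\sum_(i <- r) f i).
Proof.
move=> df; apply: big_ind => //; last by move=> g h; exact: deg_le_add.
exact: deg_le_cst.
Qed.

(** * Lowering the powers of one coordinate *)

Lemma size_prod_XsubC_lt (R : comNzRingType) (n m : nat) (a : 'I_n -> R) :
  (m <= n)%N -> size (\prod_(j < n | (j < m)%N) ('X - (a j)%:P)) = m.+1.
Proof.
move=> mn; rewrite -big_filter size_prod_XsubC size_filter -sum1_count.
by rewrite (big_ord_narrow mn) sum_nat_const card_ord muln1.
Qed.

(** Downward induction on [m] from the full product, the constant [P]. With p_m the product over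
    [j < m], the identity p_(m+1) = (t - x_m) p_m gives each coefficient of p_m from one of p_(m+1)
    and [x_m] times the next higher one of p_m. *)
Lemma deg_le_coef (T : Type) (R : comNzRingType) (n : nat)
    (x : 'I_n -> T -> R) (P : {poly R})
    (xP : forall t, \prod_(j < n) ('X - (x j t)%:P) = P) (m i : nat) :
  (m <= n)%N -> (i <= m)%N ->
  deg_le x m i (fun t => (\prod_(j < n | (j < m)%N) ('X - (x j t)%:P))`_(m - i)).
Proof.
move=> mn; have [q qE] : exists q, (m + q = n)%N by exists (n - m)%N; lia.
elim: q m i qE mn => [|q IHq] m i.
  rewrite addn0 => -> _ _; rewrite (_ : (fun t => _) = cst P`_(n - i)).
    exact: deg_le_cst.
  apply/funext => t /=; rewrite -(xP t); congr (polyseq _)`_ _.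
  by apply: eq_bigl => j; rewrite ltn_ord.
move=> qE _; have mn : (m < n)%N by lia.
elim: i => [|i IHi] im.
  rewrite subn0 (_ : (fun t => _) = cst 1); first exact: deg_le_cst.
  apply/funext => t /=; set p := (\prod_(_ < _ | _) _).
  have := size_prod_XsubC_lt (x^~ t) (ltnW mn).
  have : lead_coef p = 1 by apply/eqP/monic_prod => j _; rewrite monicXsubC.
  by rewrite lead_coefE => <- ->.
pose k := Ordinal mn.
have -> : (fun t => (\prod_(j < n | (j < m)%N) ('X - (x j t)%:P))`_(m - i.+1)) =
  (fun t => (\prod_(j < n | (j < m.+1)%N) ('X - (x j t)%:P))`_(m.+1 - i.+1)) +
  x k * (fun t => (\prod_(j < n | (j < m)%N) ('X - (x j t)%:P))`_(m - i)).
  apply/funext => t; rewrite !fctE [in RHS](bigD1 k) //=.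
  rewrite [\prod_(i0 < n | _ && _) _](_ : _ =
    \prod_(j < n | (j < m)%N) ('X - (x j t)%:P)); last first.
    by apply: eq_bigl => j; rewrite -val_eqE /=; lia.
  rewrite mulrBl coefB coefXM coefCM subSS.
  have -> : (m - i = (m - i.+1).+1)%N by lia.
  by rewrite /= addrNK.
apply: deg_le_add; first last.
  by apply: deg_le_mulX => //; apply: IHi; exact: ltnW.
by apply: deg_le_widen_vars (IHq m.+1 i.+1 _ _ _); lia.
Qed.

(** The monic product over [j <= k] vanishes at [x k]; solving for the leading power makes [c i]
    minus a coefficient, whose degree bound complements the exponent [i] to [k.+1]. *)
Lemma pow_relation (T : Type) (R : comNzRingType) (n : nat)
    (x : 'I_n -> T -> R) (P : {poly R})
    (xP : forall t, \prod_(j < n) ('X - (x j t)%:P) = P) (k : 'I_n) :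
  exists2 c : nat -> T -> R,
    forall i, (i <= k)%N -> deg_le x k.+1 (k.+1 - i) (c i)
    & x k ^+ k.+1 = \sum_(i < k.+1) x k ^+ i * c i.
Proof.
pose q t := \prod_(j < n | (j < k.+1)%N) ('X - (x j t)%:P).
exists (fun i => - (fun t => (q t)`_i)).
  move=> i ik; apply: deg_leN.
  have := deg_le_coef xP (m := k.+1) (i := (k.+1 - i)%N) (ltn_ord k).
  by rewrite subKn ?leq_subr; [apply|lia].
apply/funext => t; rewrite fct_sumE.
have szq : size (q t) = k.+2 := size_prod_XsubC_lt (x^~ t) (ltn_ord k).
have /monicP lcq : q t \is monic by apply: monic_prod => j _; exact: monicXsubC.
have : (q t).[x k t] = 0.
  by rewrite /q (bigD1 k) //= hornerM !hornerE subrr mul0r.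
rewrite horner_coef szq big_ord_recr /=.
have -> : (q t)`_k.+1 = 1 by rewrite -lcq lead_coefE szq.
rewrite mul1r addrC => /eqP; rewrite addr_eq0 => /eqP; rewrite !fctE => ->.
rewrite -sumrN; apply: eq_bigr => i _; rewrite !fctE; ring.
Qed.

(* Sums of [x k ^+ j * f] of total degree at most [d], with [j <= k] and [f] a
   polynomial in the later variables only. *)
Inductive low_pow (T : Type) (R : comNzRingType) (n : nat) (x : 'I_n -> T -> R)
    (k : 'I_n) (d : nat) : (T -> R) -> Prop :=
| low_pow_base j e f :
    (j <= k)%N -> (j + e <= d)%N -> deg_le x k.+1 e f ->
    low_pow x k d (x k ^+ j * f)
| low_pow_add f g :
    low_pow x k d f -> low_pow x k d g -> low_pow x k d (f + g).

(** Only the exponent [j = k] overflows; the relation for [x k ^+ k.+1] then lowers it without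
    raising the total degree. *)
Lemma low_powX (T : Type) (R : comNzRingType) (n : nat)
    (x : 'I_n -> T -> R) (P : {poly R})
    (xP : forall t, \prod_(j < n) ('X - (x j t)%:P) = P) (k : 'I_n)
    (d : nat) (f : T -> R) :
  low_pow x k d f -> low_pow x k d.+1 (x k * f).
Proof.
elim=> {f} [j e f jk jed df|f g _ IHf _ IHg]; last first.
  by rewrite mulrDr; exact: low_pow_add.
rewrite mulrA -exprS; move: jk jed; rewrite leq_eqVlt => /orP[/eqP ->|jk] jed.
  have [c dc ->] := pow_relation xP k.
  rewrite mulr_suml; apply: big_ind.
  (* [low_pow] has no constructor for zero, so the empty sum is written as [x k ^+ 0] times zero. *)
  - rewrite -[0](mulr0 (x k ^+ 0)); apply: (@low_pow_base _ _ _ _ _ _ _ 0) => //.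
    exact: deg_le_cst.
  - by move=> g h; exact: low_pow_add.
  - move=> i _; rewrite -mulrA.
    have ik : (i <= k)%N by rewrite -ltnS.
    by apply: low_pow_base (deg_leM (dc i ik) df) => //; lia.
by apply: low_pow_base df => //; lia.
Qed.

Lemma deg_le_low_pow (T : Type) (R : comNzRingType) (n : nat)
    (x : 'I_n -> T -> R) (P : {poly R})
    (xP : forall t, \prod_(j < n) ('X - (x j t)%:P) = P) (k : 'I_n)
    (d : nat) (f : T -> R) :
  deg_le x k d f -> low_pow x k d f.
Proof.
elim=> {d f} [d c|d f g _ IHf _ IHg|d i f ki _ IH].
- rewrite -[cst c](mul1r (cst c)) -(expr0 (x k)).
  apply: (@low_pow_base _ _ _ _ _ _ _ 0) => //; exact: deg_le_cst.
- exact: low_pow_add.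
- move: ki; rewrite leq_eqVlt => /orP[/eqP/val_inj <-|ki].
    exact: low_powX xP _ _ _ IH.
  elim: IH => {f} [j e f jk jed df|f g _ IHf _ IHg]; last first.
    by rewrite mulrDr; exact: low_pow_add.
  rewrite mulrCA; apply: (@low_pow_base _ _ _ _ _ _ _ e.+1) => //.
    by rewrite addnS.
  exact: deg_le_mulX.
Qed.

(** Spanning by the staircase monomials, phrased as an induction principle. Variables are treated in
    increasing order: reducing in [x k] leaves cofactors in later variables only, so exponents
    already fixed stay untouched. *)
Lemma deg_le_staircase_ind (T : Type) (R : comNzRingType) (n s : nat)
    (x : 'I_n -> T -> R) (P : {poly R})
    (xP : forall t, \prod_(j < n) ('X - (x j t)%:P) = P)
    (V : (T -> R) -> Prop)
    (VD : forall f g, V f -> V g -> V (f + g))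
    (Vmon : forall c (u : 'I_n -> nat), (forall i, (u i <= i)%N) ->
      (\sum_i u i <= s)%N -> V (cst c * \prod_i x i ^+ u i)) (f : T -> R) :
  deg_le x 0 s f -> V f.
Proof.
(* Invariant: [u] stores the exponents fixed before [k], and [g] involves only the variables from
   [k] on. *)
move=> df; suff H q k (u : 'I_n -> nat) d g : (k + q = n)%N ->
    (forall i, (u i <= i)%N) -> (forall i : 'I_n, (k <= i)%N -> u i = 0%N) ->
    (\sum_i u i + d <= s)%N -> deg_le x k d g -> V (g * \prod_i x i ^+ u i).
  have := H n 0%N (fun=> 0%N) s f; rewrite big1 // big1 ?mulr1 //.
  exact.
elim: q k u d g => [|q IHq] k u d g kqn ule u0 usd dg.
  rewrite addn0 in kqn; subst k.
  elim: dg usd => {d g} [d c|d g h _ IHg _ IHh|d i g ni _ _] usd.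
  - by apply: Vmon => //; lia.
  - by rewrite mulrDl; apply: VD; [exact: IHg|exact: IHh].
  - by move: ni; rewrite leqNgt ltn_ord.
have kn : (k < n)%N by lia.
have := @deg_le_low_pow _ _ _ _ _ xP (Ordinal kn) _ _ dg.
set k' := Ordinal kn.
elim=> {dg g} [j e h jk jed dh|g h _ IHg _ IHh]; last first.
  by rewrite mulrDl; exact: VD.
(* The slot [k'] is still empty in [u], by [u0], and receives the exponent [j]. *)
pose v i := (u i + (i == k') * j)%N.
have -> : x k' ^+ j * h * \prod_i x i ^+ u i = h * \prod_i x i ^+ v i.
  rewrite (bigD1 k') //= [in RHS](bigD1 k') //= /v eqxx mul1n exprD.
  rewrite [in RHS](eq_bigr (fun i => x i ^+ u i)); first by ring.
  by move=> i /negPf ->; rewrite mul0n addn0.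
apply: (IHq k.+1 v e) => //.
- by rewrite addSnnS.
- move=> i; rewrite /v; case: eqP => [->|_]; last by rewrite mul0n addn0.
  by rewrite u0 // mul1n.
- move=> i ki; rewrite /v u0 ?(ltnW ki) //.
  by case: eqP => // ik; move: ki; rewrite ik ltnn.
- rewrite /v big_split /= (bigD1 k' (P := xpredT) (F := fun i => ((i == k') * j)%N)) //=.
  rewrite eqxx mul1n [\sum_(i | i != k') _]big1; last by move=> i /negPf ->.
  by rewrite addn0 -addnA; apply: leq_trans usd; rewrite leq_add2l.
Qed.

(** * Lehmer codes and inversions *)

(** Each inversion is charged to its right end, so that the entry at [i] obeys the same bound as the
    exponents above. *)
Definition lehmer (n : nat) (sigma : 'S_n) (i : 'I_n) : nat :=
  #|[set j : 'I_n | (j < i)%N && (sigma i < sigma j)%N]%SET|.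

Lemma inversionsE (n : nat) (sigma : 'S_n) :
  inversions sigma = (\sum_i lehmer sigma i)%N.
Proof.
rewrite /inversions -sum1_card; under eq_bigl do rewrite inE.
rewrite -(pair_big_dep xpredT
  (fun i j : 'I_n => (i < j)%N && (sigma j < sigma i)%N) (fun _ _ => 1%N)) /=.
rewrite (exchange_big_dep xpredT) //=.
by apply: eq_bigr => i _; rewrite /lehmer -sum1_card; apply: eq_bigl => j; rewrite inE.
Qed.

Lemma lehmer_le (n : nat) (sigma : 'S_n) (i : 'I_n) : (lehmer sigma i <= i)%N.
Proof.
have <- : #|[set j : 'I_n | (j < i)%N]%SET| = i.
  rewrite -sum1_card; under eq_bigl do rewrite inE.
  by rewrite (big_ord_narrow (ltnW (ltn_ord i))) sum_nat_const card_ord muln1.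
by apply: subset_leq_card; apply/fintype.subsetP => j; rewrite !inE => /andP[].
Qed.

Lemma lehmer_inj (n : nat) (sigma tau : 'S_n) :
  lehmer sigma =1 lehmer tau -> sigma = tau.
Proof.
move=> L; apply/permP => i.
have [m] := ubnP (n - i); elim: m i => // m IH i nim.
have agree (j : 'I_n) : (i < j)%N -> sigma j = tau j.
  by move=> ij; apply: IH; have := ltn_ord j; lia.
wlog lt_st : sigma tau L IH agree / (sigma i < tau i)%N.
  move=> W; case: (ltngtP (sigma i) (tau i)) => [|ts|/val_inj //]; first exact: W.
  symmetry; apply: (W tau sigma) => // [j jm|j ij]; first by rewrite IH.
  by rewrite agree.
(* Counting values instead of positions makes the sets for [sigma] and [tau] comparable. *)
have img (rho : 'S_n) : lehmer rho i =
    #|[set y : 'I_n | (rho i < y)%N && ((rho^-1)%g y < i)%N]%SET|.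
  rewrite -(card_preimset _ (@perm_inj _ rho)); apply: eq_card => j.
  by rewrite !inE permK andbC.
have inv_lt (y : 'I_n) : ((sigma^-1)%g y <= i)%N = ((tau^-1)%g y <= i)%N.
  rewrite leqNgt [RHS]leqNgt; congr (~~ _); apply/idP/idP => h.
    by rewrite -{1}(permKV sigma y) agree // permK.
  by rewrite -{1}(permKV tau y) -agree // permK.
(* The set for [tau] lies strictly inside that for [sigma]; [tau i] is the extra element. *)
have := L i; rewrite !img => /eqP; rewrite gtn_eqF //.
apply: proper_card; apply/properP; split.
  apply/fintype.subsetP => y; rewrite !inE => /andP[ty yi].
  rewrite (ltn_trans lt_st ty) /= ltn_neqAle inv_lt (ltnW yi) andbT.
  apply/negP => /eqP/val_inj yE; move: ty.
  by rewrite -(permKV sigma y) yE ltnNge (ltnW lt_st).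
exists (tau i); rewrite !inE ?ltnn // lt_st /= ltn_neqAle inv_lt permK leqnn andbT.
by apply/negP => /eqP/val_inj yE; move: lt_st; rewrite -(permKV sigma (tau i)) yE ltnn.
Qed.

(** By counting: [lehmer] is injective, and there are as many admissible vectors, the product of the
    [i.+1], as permutations. *)
Lemma lehmer_surj (n : nat) (u : 'I_n -> nat) :
  (forall i, (u i <= i)%N) -> exists sigma : 'S_n, lehmer sigma =1 u.
Proof.
move=> ule.
have ltu i : (u i < n)%N := leq_ltn_trans (ule i) (ltn_ord i).
have ltL sigma i : (lehmer sigma i < n)%N :=
  leq_ltn_trans (@lehmer_le n sigma i) (ltn_ord i).
pose L (sigma : 'S_n) := [ffun i => Ordinal (ltL sigma i)].
pose C := family (fun i : 'I_n => [pred j : 'I_n | (j <= i)%N]).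
have L_inj : injective L.
  move=> s t /ffunP st; apply: lehmer_inj => i.
  by have := congr1 val (st i); rewrite !ffunE.
have LC : codom L \subset C.
  apply/fintype.subsetP => f /codomP[s ->]; apply/familyP => i.
  by rewrite ffunE inE /= lehmer_le.
have cardC : #|C| = n`!.
  rewrite card_family foldrE big_map big_enum /= fact_prod big_add1 /= big_mkord.
  apply: eq_bigr => i _; rewrite -sum1_card /=.
  rewrite (eq_bigl (fun j : 'I_n => (j < i.+1)%N)) //.
  by rewrite (big_ord_narrow (ltn_ord i)) sum_nat_const card_ord muln1.
have eqLC : codom L =i C.
  by apply/subset_cardP => //; rewrite card_codom // cardC card_Sn.
have : [ffun i => Ordinal (ltu i)] \in C.
  by apply/familyP => i; rewrite ffunE inE /=.
rewrite -eqLC => /codomP[s /ffunP us]; exists s => i.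
by have := congr1 val (us i); rewrite !ffunE.
Qed.

Lemma card_inversions_le (n s : nat) :
  #|[set sigma : 'S_n | (inversions sigma <= s)%N]%SET| =
  (\sum_(0 <= i < s.+1) num_perm_inv n i)%N.
Proof.
rewrite big_mkord -sum1_card; under eq_bigl do rewrite inE.
(* [inord] is faithful here, since only inversion numbers at most [s] occur. *)
rewrite (partition_big (fun sigma => inord (inversions sigma) : 'I_s.+1) xpredT) //=.
apply: eq_bigr => i _; rewrite /num_perm_inv -sum1_card; apply: eq_bigl => sigma.
rewrite inE -ltnS; apply/andP/eqP => [[si /eqP <-]|si]; first by rewrite inordK.
by split; [rewrite si|rewrite -val_eqE /= inordK si].
Qed.

(** * A rank bound *)

(** On [B] the matrix of [f] is diagonal and invertible, hence of rank [#|B|], yet it factors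
    through dimension [#|S|]. *)
Lemma card_le_separated (F : fieldType) (I J : finType) (B : {set I})
    (S : {set J}) (f : I -> I -> F) (m : J -> I -> F)
    (f_diag : forall a, a \in B -> f a a != 0)
    (f_offdiag : forall a b, a \in B -> b \in B -> a != b -> f a b = 0)
    (f_span : forall a, a \in B ->
      exists c, forall b, f a b = \sum_(j in S) c j * m j b) :
  (#|B| <= #|S|)%N.
Proof.
pose e (i : 'I_#|B|) := enum_val i.
have /boolp.choice[c cE] : forall i : 'I_#|B|, exists c, forall b,
    f (e i) b = \sum_(j in S) c j * m j b.
  by move=> i; apply: f_span; exact: enum_valP.
pose D := diag_mx (\row_i f (e i) (e i)).
have DE : D = (\matrix_(i < #|B|, j < #|S|) c i (enum_val j)) *m
              (\matrix_(j < #|S|, i < #|B|) m (enum_val j) (e i)).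
  apply/matrixP => i j; rewrite !mxE.
  transitivity (f (e i) (e j)).
    case: eqP => [->|/eqP ij]; first by rewrite mulr1n.
    rewrite mulr0n f_offdiag ?enum_valP //.
    by apply: contraNneq ij => /enum_val_inj ->.
  by rewrite cE big_enum_val; apply: eq_bigr => k _; rewrite !mxE.
have Du : D \in unitmx.
  rewrite unitmxE det_diag unitfE; apply/prodf_neq0 => i _.
  by rewrite mxE f_diag // enum_valP.
rewrite -(mxrank_unit Du) DE.
exact: leq_trans (mxrankM_maxl _ _) (rank_leq_col _).
Qed.

(** * Distance polynomials *)

(** Both sums of squares in the expansion equal [\sum_i alpha i ^+ 2], so only the linear cross
    terms depend on [tau]. *)
Lemma deg_le_sqdist (R : realType) (n : nat) (alpha : 'I_n -> R)
    (sigma : 'S_n) (r : R) :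
  deg_le (fun (i : 'I_n) (tau : 'S_n) => alpha (tau i)) 0 1
    (fun tau => \sum_i (alpha (tau i) - alpha (sigma i)) ^+ 2 - r).
Proof.
set x := fun (i : 'I_n) (tau : 'S_n) => alpha (tau i).
rewrite (_ : (fun tau => _) =
    cst ((\sum_i alpha i ^+ 2) *+ 2 - r) +
    \sum_i x i * cst (- 2 * alpha (sigma i))).
  apply: deg_le_add; first exact: deg_le_cst.
  apply: deg_le_sum => i; apply: deg_le_mulX => //; exact: deg_le_cst.
have sum_perm (rho : 'S_n) : \sum_i alpha (rho i) ^+ 2 = \sum_i alpha i ^+ 2.
  by rewrite [RHS](reindex_inj (@perm_inj _ rho)).
apply/funext => tau; rewrite fct_sumE !fctE mulr2n -{1}(sum_perm tau).
rewrite -(sum_perm sigma) addrAC; congr (_ - r).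
by rewrite -!big_split /=; apply: eq_bigr => i _; rewrite !fctE /x; ring.
Qed.

Lemma s_distance_seq (R : realType) (n s : nat) (A : set 'rV[R]_n) :
  is_s_distance_set s A ->
  exists2 ds : seq R, (size ds <= s)%N &
    forall r, distance_set A r <-> r \in ds.
Proof.
move=> hs; have fin : finite_set (distance_set A) by apply: card_le_finite hs _.
exists (finmap.enum_fset (fset_set (distance_set A))).
  exact: geq_card_fset_set hs.
by move=> r; rewrite [_ \in _](in_fset_set fin); split; [exact: mem_set|exact: set_mem].
Qed.

Lemma euclid_dist_neq0 (R : realType) (n : nat) (p q : 'rV[R]_n) :
  p <> q -> euclid_dist p q != 0.
Proof.
move=> pq; apply/eqP => d0; apply: pq; apply/rowP => i; apply/eqP.
rewrite -subr_eq0 -sqrf_eq0; move/eqP: d0.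
rewrite sqrtr_eq0 => le0; apply/eqP/le_anti; rewrite sqr_ge0 andbT.
apply: le_trans le0; rewrite (bigD1 i) //= lerDl.
by apply: sumr_ge0 => j _; exact: sqr_ge0.
Qed.

Theorem corollary1p7 (R : realType) (n s : nat) (hn : (1 <= n)%N)
    (alpha : 'I_n -> R) (alpha_inj : injective alpha)
    (A : set 'rV[R]_n) (hA : (A `<=` perm_vectors alpha)%classic)
    (hs : is_s_distance_set s A) :
  (A #<= `I_(\sum_(0 <= i < s.+1) num_perm_inv n i)%N)%card.
Proof.
pose pt (sigma : 'S_n) : 'rV[R]_n := \row_(i < n) alpha (sigma i).
(* [pt] maps [B] onto [A], so it suffices to bound [#|B|]. *)
pose B := [set sigma | `[< A (pt sigma) >]]%SET.
have ABim : (A `<=` pt @` [set` B])%classic.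
  move=> p Ap; have [sigma pE] := hA _ Ap; exists sigma; last by rewrite pE.
  by rewrite /= inE; apply/asboolP; rewrite /pt -pE.
apply: (card_le_trans (subset_card_le ABim)).
apply: (card_le_trans (card_image_le _ _)).
suff leB : (#|B| <= \sum_(0 <= i < s.+1) num_perm_inv n i)%N.
  have Bim : ([set` B] `<=` (@enum_val _ (mem B)) @` [set: 'I_#|B|])%classic.
    by move=> a Ba; exists (enum_rank_in Ba a) => //; exact: enum_rankK_in.
  apply: (card_le_trans (subset_card_le Bim)).
  apply: (card_le_trans (card_image_le _ _)).
  by rewrite -(card_le_eql card_II) card_le_II.
rewrite -card_inversions_le.
have [ds size_ds dsP] := s_distance_seq hs.
pose x (i : 'I_n) (tau : 'S_n) := alpha (tau i).
have sqdistE sigma tau : euclid_dist (pt tau) (pt sigma) ^+ 2 =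
    \sum_i (alpha (tau i) - alpha (sigma i)) ^+ 2.
  rewrite sqr_sqrtr; last by apply: sumr_ge0 => i _; exact: sqr_ge0.
  by apply: eq_bigr => i _; rewrite !mxE.
pose f (sigma tau : 'S_n) :=
  \prod_(d <- ds) (\sum_i (alpha (tau i) - alpha (sigma i)) ^+ 2 - d ^+ 2).
(* Lehmer codes index the spanning monomials by permutations; the degree is the inversion number. *)
apply: (@card_le_separated R _ _ B _ f (fun sigma tau => \prod_i x i tau ^+ lehmer sigma i)).
(* On the diagonal each factor is [- d ^+ 2], with [d] a distance between distinct points. *)
- move=> sigma _; rewrite prodf_seq_neq0; apply/allP => d /dsP[p [q [_ _ pq ->]]] /=.
  rewrite big1 => [|i _]; last by rewrite subrr expr0n.
  by rewrite sub0r oppr_eq0 sqrf_eq0 euclid_dist_neq0.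
(* The factor for the distance between the two points vanishes; [alpha_inj] makes them distinct. *)
- move=> sigma tau; rewrite !inE => As At st.
  apply/eqP; rewrite prodf_seq_eq0; apply/hasP.
  exists (euclid_dist (pt tau) (pt sigma)); last by rewrite /= -sqdistE subrr.
  apply/dsP; exists (pt tau), (pt sigma); split=> // /rowP ts.
  case/eqP: st; apply/permP => i; apply: alpha_inj.
  by have := ts i; rewrite !mxE.
move=> sigma _.
have df : deg_le x 0 s (f sigma).
  apply: deg_le_widen size_ds _; rewrite /f; elim: (ds) => [|e ds' IH].
    rewrite (_ : (fun tau => _) = cst 1); first exact: deg_le_cst.
    by apply/funext => tau; rewrite big_nil.
  rewrite (_ : (fun tau => _) =
      (fun tau : 'S_n => \sum_i (alpha (tau i) - alpha (sigma i)) ^+ 2 - e ^+ 2) *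
      (fun tau : 'S_n => \prod_(d <- ds')
        (\sum_i (alpha (tau i) - alpha (sigma i)) ^+ 2 - d ^+ 2))).
    exact: deg_leM (deg_le_sqdist _ _ _) IH.
  by apply/funext => tau; rewrite !fctE big_cons.
have xP tau : \prod_i ('X - (x i tau)%:P) = \prod_i ('X - (alpha i)%:P).
  by rewrite [RHS](reindex_inj (@perm_inj _ tau)).
pose V (g : 'S_n -> R) := exists c : 'S_n -> R, forall tau, g tau =
  \sum_(rho in [set rho : 'S_n | (inversions rho <= s)%N]%SET)
    c rho * \prod_i x i tau ^+ lehmer rho i.
apply: (deg_le_staircase_ind xP (V := V) _ _ df) => [g h [c gE] [e hE]|c u ule us].
  exists (fun j => c j + e j) => tau; rewrite fctE gE hE -big_split /=.
  by apply: eq_bigr => j _; rewrite mulrDl.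
(* The exponent vector [u] is the code of some [rho], so the coefficients are concentrated there. *)
have [rho rhoE] := lehmer_surj ule.
exists (fun j => c *+ (j == rho)) => tau.
rewrite (bigD1 rho) /=; last first.
  by rewrite inE inversionsE (eq_bigr _ (fun i _ => rhoE i)).
rewrite eqxx mulr1n [X in _ + X]big1 => [|j /andP[_ /negPf ->]]; last by rewrite mul0r.
rewrite addr0 fctE; congr (_ * _).
by rewrite fct_prodE; apply: eq_bigr => i _; rewrite exprfctE rhoE.
Qed.
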